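(* Let $I\subset\mathbb R$ and $Z\subset\mathbb R$ be bounded intervals, put $L=|I||Z|$, and suppose that $\Gamma=\Gamma(r,z,t)$ satisfies $$\Gamma(0,z,t)=0,\qquad|\Gamma(r,z,t)|\le\omega\qquad\text{for }0<r<1,\ (z,t)\in Z\times I.$$ Define $$E=\int_I\int_Z\int_0^1\frac{|\partial_r\Gamma|^2}{r}\,dr\,dz\,dt.$$ Then $$\int_I\int_Z\int_0^1\frac{\Gamma^2}{r}\,dr\,dz\,dt\le L\,\omega^2\left[\frac14+\frac12\log\left(1+\frac{E}{L\omega^2}\right)\right].$$ Consequently, for a sequence $\Gamma_j$ and intervals $I_j,Z_j\subset\mathbb R$ of uniformly bounded length such that $\Gamma_j(0,z,t)=0$ and $|\Gamma_j(r,z,t)|\le\omega_j$ for $0<r<1$, $(z,t)\in Z_j\times I_j$, with energies $E_j=\int_{I_j}\int_{Z_j}\int_0^1\frac{|\partial_r\Gamma_j|^2}{r}\,dr\,dz\,dt$ and with $F_j=\Gamma_j/r^2$, the condition $$\omega_j^2\left[1+\log\left(1+\frac{E_j}{\omega_j^2}\right)\right]\longrightarrow0$$ implies $F_j^2\to0$ in local $L^1(d\mu_5\,dt)$, i.e. $\int_{I_j}\int_{Z_j}\int_0^1F_j^2\,d\mu_5\,dt\to0$.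
   Context: $d\mu_5=r^3\,dr\,dz$. In the application $\Gamma=ru^\theta$ is the circulation of a smooth axisymmetric flow and $F=\Gamma/r^2=u^\theta/r$; it suffices that $\Gamma$ is measurable and, for almost every $(z,t)$, locally absolutely continuous in $r\in(0,1)$ with $\Gamma(r,z,t)\to0$ as $r\downarrow0$. Expressions of the form $\omega^2\log(1+E/\omega^2)$ are read as $0$ when $\omega=0$; the first inequality is trivial if $E=\infty$. *)

(* Defs.v *)
From HB Require Import structures.
From mathcomp Require Import all_boot all_order all_algebra.
From mathcomp Require Import all_classical all_reals all_analysis.

Set Implicit Arguments.
Unset Strict Implicit.
Unset Printing Implicit Defensive.

Import Order.TTheory GRing.Theory Num.Theory.
Import numFieldNormedType.Exports.

Local Open Scope classical_set_scope.
Local Open Scope ring_scope.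

Section Defs.
Context {R : realType}.
Implicit Types (I Z : set R) (w a b : R) (f : R -> R) (G : R -> R -> R -> R).

Local Notation mu := (@lebesgue_measure R).

Definition abs_continuous_itv a b f : Prop :=
  forall e : R, 0 < e -> exists2 d : R, 0 < d &
    forall (n : nat) (u v : 'I_n -> R),
      (forall i, [/\ a <= u i, u i <= v i & v i <= b]) ->
      trivIset [set: 'I_n] (fun i => `]u i, v i[%classic) ->
      \sum_(i < n) (v i - u i) < d ->
      \sum_(i < n) `|f (v i) - f (u i)| < e.

Definition locally_abs_continuous01 f : Prop :=
  forall a b, 0 < a -> a <= b -> b < 1 -> abs_continuous_itv a b f.

(* Lebesgue (not only Borel) measurability of G on ]0, 1[ x Z x I: since
   [lebesgue_measure] lives on the Borel sets, it is expressed as equality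
   almost everywhere to a Borel function. *)
Definition lebesgue_measurable3 Z I G : Prop :=
  let RB := measurableTypeR R in
  let D : set (RB * RB * RB) := (`]0, 1[%classic `*` Z) `*` I in
  exists2 g : RB * RB * RB -> RB,
    measurable_fun D g &
    ae_eq ((mu \x mu) \x mu)%E D (fun x => G x.1.1 x.1.2 x.2) g.

(* The boundary condition G(0, z, t) = 0 is the limit of G(r, z, t) as r
   decreases to 0; the value of the function G at r = 0 plays no role. *)
Definition circulation Z I G : Prop :=
  lebesgue_measurable3 Z I G /\
  {ae (mu \x mu)%E, forall x : R * R, Z x.1 -> I x.2 ->
    locally_abs_continuous01 (fun r => G r x.1 x.2) /\
    G r x.1 x.2 @[r --> 0^'+] --> (0 : R)}.

Definition bounded_circulation Z I w G : Prop :=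
  forall r z t, 0 < r < 1 -> Z z -> I t -> `|G r z t| <= w.

(* The integral of a nonnegative function is the supremum of the integrals of
   the Borel simple functions below it, which is also the right value for a
   function that is only Lebesgue measurable. *)
Definition integral3 Z I (h : R -> R -> R -> R) : \bar R :=
  (\int[mu]_(t in I) \int[mu]_(z in Z) \int[mu]_(r in `]0%R, 1%R[)
    (h r z t)%:E)%E.

(* [derive1] has an unspecified value where the derivative does not exist; for
   a circulation this is a null set of (r, z, t). *)
Definition energy Z I G : \bar R :=
  integral3 Z I (fun r z t => `|derive1 (fun s => G s z t) r| ^+ 2 / r).

Definition angular G : R -> R -> R -> R := fun r z t => G r z t / r ^+ 2.

(* integral against d mu_5 dt, where d mu_5 = r ^ 3 dr dz *)
Definition integral_mu5 Z I (h : R -> R -> R -> R) : \bar R :=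
  integral3 Z I (fun r z t => h r z t * r ^+ 3).

Definition length I : R := fine (mu I).

(* log (1 + E / x), with log (1 + oo) = oo. For x = 0, E / x is read as
   E * 0 = 0, so that x * log (1 + E / x) = 0, even when E = oo. *)
Definition log1 (E : \bar R) (x : R) : \bar R := lne (1 + E * (x^-1)%:E)%E.

End Defs.

(* Main.v *)
Require Import Defs.
From HB Require Import structures.
From mathcomp Require Import all_boot all_order all_algebra.
From mathcomp Require Import all_classical all_reals all_analysis.
From mathcomp Require Import measurable_realfun ring lra.

Import Order.TTheory GRing.Theory Num.Theory.
Import numFieldNormedType.Exports.

Local Open Scope classical_set_scope.
Local Open Scope ring_scope.

(* Fix (z, t), put f = Gamma(., z, t) and e = int_0^1 |f'|^2 / r dr. By
   Cauchy-Schwarz f(r)^2 <= e r^2 / 2, while f(r)^2 <= w^2; using the first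
   bound below a radius a and the second one above it,
     int_0^1 f^2 / r dr <= e a^2 / 4 + w^2 log (1 / a).
   Choosing the same a for all (z, t) and integrating gives
     int int int Gamma^2 / r <= E a^2 / 4 + L w^2 log (1 / a),
   so no concavity argument is needed: a^2 = 1 / (1 + E / (L w^2)) yields the
   inequality, and a^2 = 1 / (1 + E / w^2) its consequence for sequences.

   The Cauchy-Schwarz step rests on the fundamental theorem of calculus for
   absolutely continuous functions. It is obtained by writing f as the
   difference of its total variation and of another nondecreasing absolutely
   continuous function: the Stieltjes measure of such a function is dominated
   by the Lebesgue measure, and Lebesgue's differentiation theorem identifies
   its Radon-Nikodym density with the derivative. *)

(** * Absolutely continuous functions *)

Section AbsContinuousFamilies.
Context {R : realType}.
Implicit Types (a b e d : R) (f g : R -> R) (s : seq (R * R)).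

(** A shared endpoint is allowed, so that consecutive pieces of a partition qualify. The relation is
    symmetric, hence insensitive to the order of the family. *)
Definition separated (p q : R * R) : bool := (p.2 <= q.1) || (q.2 <= p.1).

Definition subitv a b (p : R * R) : bool :=
  [&& a <= p.1, p.1 <= p.2 & p.2 <= b].

(** The weak bound by [e] survives the supremum that defines the total variation. Families are lists
    because the refinement argument concatenates and permutes them. *)
Definition oscillation_small a b f e d : Prop :=
  forall s, all (subitv a b) s -> pairwise separated s ->
    \sum_(p <- s) (p.2 - p.1) < d -> \sum_(p <- s) `|f p.2 - f p.1| <= e.

Definition abs_continuous_seq a b f : Prop :=
  forall e, 0 < e -> exists2 d, 0 < d & oscillation_small a b f e d.

Lemma abs_continuous_itv_seq a b f :
  abs_continuous_itv a b f -> abs_continuous_seq a b f.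
Proof.
move=> acf e e0; have [d d0 fd] := acf e e0; exists d => // s abs seps sd.
pose u (i : 'I_(size s)) := (nth (0, 0) s i).1.
pose v (i : 'I_(size s)) := (nth (0, 0) s i).2.
have nthE (F : R * R -> R) :
    \sum_(p <- s) F p = \sum_(i < size s) F (nth (0, 0) s i).
  by rewrite (big_nth (0, 0)) big_mkord.
rewrite nthE; apply/ltW/(fd _ u v).
- by move=> i; apply/and3P/(allP abs)/mem_nth.
- apply/trivIsetP => i j _ _ ij.
  wlog lij : i j ij / (i < j)%N.
    move=> wl; have [/wl->//|ji|/ord_inj/eqP] := ltngtP i j; last by rewrite (negbTE ij).
    by rewrite setIC wl// eq_sym.
  have /(pairwiseP (0, 0))/(_ i j) := seps.
  rewrite !inE !ltn_ord => /(_ isT isT lij) /orP sp.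
  apply/seteqP; split => // x [/=]; rewrite !in_itv/= => /andP[ux xv] /andP[ux' xv'].
  case: sp => [h|h].
    by have := lt_le_trans xv h; rewrite ltNge (ltW ux').
  by have := lt_le_trans xv' h; rewrite ltNge (ltW ux).
- by rewrite -(nthE (fun p => p.2 - p.1)).
Qed.

Lemma abs_continuous_seqB a b f g :
  abs_continuous_seq a b f -> abs_continuous_seq a b g ->
  abs_continuous_seq a b (f \- g).
Proof.
move=> acf acg e e0; have e20 : 0 < e / 2 by rewrite divr_gt0.
have [d d0 fd] := acf _ e20; have [d' d'0 gd'] := acg _ e20.
exists (Num.min d d'); first by rewrite lt_min d0.
move=> s abs seps; rewrite lt_min => /andP[sd sd'].
rewrite [e]splitr; apply: le_trans (lerD (fd s abs seps sd) (gd' s abs seps sd')).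
rewrite -big_split/=; apply: ler_sum => p _.
by rewrite opprD addrACA (le_trans (ler_normD _ _))// -opprD normrN.
Qed.

Fixpoint chain (x : R) (t : seq R) : seq (R * R) :=
  if t is y :: t' then (x, y) :: chain y t' else [::].

Lemma path_le_last (x : R) t : path <%R x t -> x <= last x t.
Proof.
by elim: t x => //= y t ih x /andP[xy /ih]; exact/le_trans/ltW.
Qed.

Lemma chain_subitv x t : path <%R x t -> all (subitv x (last x t)) (chain x t).
Proof.
elim: t x => //= y t ih x /andP[xy yt].
have := ih _ yt; rewrite /subitv/= lexx (ltW xy)/= => ht.
have yl := path_le_last _ _ yt.
rewrite yl/=; apply: sub_all ht => p /and3P[yp -> ->].
by rewrite (le_trans (ltW xy) yp).
Qed.

Lemma chain_separated x t : path <%R x t -> pairwise separated (chain x t).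
Proof.
elim: t x => //= y t ih x /andP[xy yt]; rewrite ih// andbT.
by apply: sub_all (chain_subitv _ _ yt) => p /and3P[yp _ _]; rewrite /separated/= yp.
Qed.

Lemma chain_length x t : \sum_(p <- chain x t) (p.2 - p.1) = last x t - x.
Proof.
elim: t x => [|y t ih] x /=; first by rewrite big_nil subrr.
by rewrite big_cons ih/= addrC addrA subrK.
Qed.

Lemma variation_chain a b f t :
  variation a b f t = \sum_(p <- chain a t) `|f p.2 - f p.1|.
Proof.
elim: t a => [|y t ih] a; first by rewrite variation_nil big_nil.
rewrite big_cons/= -ih /variation/= big_nat_recl//=.
Qed.

Notation TV := total_variation.

(* The subintervals of [s1] are replaced one at a time by arbitrarily fine
   partitions of themselves. *)
Lemma oscillation_small_TV a b f e d : oscillation_small a b f e d ->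
  forall s1 s2, all (subitv a b) (s1 ++ s2) -> pairwise separated (s1 ++ s2) ->
    \sum_(p <- s1 ++ s2) (p.2 - p.1) < d ->
    (\sum_(p <- s1) TV p.1 p.2 f + (\sum_(p <- s2) `|f p.2 - f p.1|)%:E <= e%:E)%E.
Proof.
move=> fd; elim=> [|[u v] s1 ih] s2.
  by rewrite big_nil add0e lee_fin; exact: fd.
rewrite cat_cons big_cons/= => /andP[/and3P/=[au uv vb] abs] /andP[sepuv seps] sd.
rewrite big_cons/= -addeA.
set X : \bar R := (\sum_(j <- s1) _ + _)%E.
have X0 : (0 <= X)%E.
  apply: adde_ge0; last by rewrite lee_fin sumr_ge0.
  rewrite big_seq; apply: sume_ge0 => p ps1; apply: total_variation_ge0.
  by move: abs; rewrite all_cat => /andP[/allP/(_ _ ps1)/and3P[]].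
suff key t : itv_partition u v t -> ((variation u v f t)%:E + X <= e%:E)%E.
  (* Some partition of [[u, v]] exists, so [key] bounds [X] by a real number. Being finite, [X] can
     be moved to the other side before taking the supremum over all partitions. *)
  have Xfin : X \is a fin_num.
    have [t tP] : exists t, itv_partition u v t.
      move: uv; rewrite le_eqVlt => /predU1P[<-|uv]; first by exists [::]; split => //=.
      by exists [:: v]; exact: itv_partition1.
    have := key _ tP; have := variation_ge0 u v f t.
    move: X0 {key}; case: X => //= _ _; by rewrite addey.
  rewrite -leeBrDr//; apply: ge_ereal_sup => _ [_ [t tP <-] <-].
  by rewrite leeBrDr//; exact: key.
move=> [ut /eqP lt].
have tuv := chain_subitv _ _ ut; rewrite lt in tuv.
(* The pieces of the partition join the second list in place of [(u, v)]; the total length does not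
   change. *)
have := ih (chain u t ++ s2); rewrite catA.
have pe : perm_eq ((s1 ++ chain u t) ++ s2) (chain u t ++ (s1 ++ s2)).
  by rewrite -!catA perm_catCA.
rewrite (perm_all _ pe) (perm_big _ pe)/= all_cat abs andbT big_cat/= chain_length lt.
rewrite variation_chain [\sum_(p <- chain u t ++ s2) _]big_cat/= EFinD addeCA; apply => //.
  apply: sub_all tuv => p /and3P[up pp pv].
  by rewrite /subitv (le_trans au up) pp (le_trans pv vb).
have chs p q : p \in chain u t -> q \in s1 ++ s2 -> separated p q.
  move=> /(allP tuv)/and3P[up pp pv] /(allP sepuv).
  by rewrite /separated/= => /orP[h|h];
    [rewrite (le_trans pv h)|rewrite (le_trans h up) orbT].
move: seps; rewrite !pairwise_cat allrel_catl chain_separated// => /and3P[-> -> ->].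
rewrite !andbT; apply/andP; split; apply/allrelP => p q hp hq.
  by apply: chs; rewrite // mem_cat hq orbT.
by rewrite /separated orbC; apply: chs; rewrite // mem_cat hp.
Qed.

Lemma abs_continuous_TV_small a b f e : 0 < e -> abs_continuous_seq a b f ->
  exists2 d, 0 < d & forall s, all (subitv a b) s -> pairwise separated s ->
    \sum_(p <- s) (p.2 - p.1) < d -> (\sum_(p <- s) TV p.1 p.2 f <= e%:E)%E.
Proof.
move=> e0 acf; have [d d0 fd] := acf e e0; exists d => // s abs seps sd.
have := oscillation_small_TV _ _ _ _ _ fd s [::].
by rewrite cats0 big_nil adde0; apply.
Qed.

(** For a suitable [d], the variation over an interval shorter than [d] is at most 1, and finitely
    many steps of length [d / 2] lead from [a] to [x]. *)
Lemma abs_continuous_TV_fin a b f : abs_continuous_seq a b f ->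
  forall x, a <= x <= b -> TV a x f \is a fin_num.
Proof.
move=> acf; have [d d0 fd] := abs_continuous_TV_small _ _ _ _ ltr01 acf.
have step u v : a <= u -> u <= v -> v <= b -> v - u < d -> TV u v f \is a fin_num.
  move=> au uv vb vud; rewrite ge0_fin_numE ?total_variation_ge0//.
  have := fd [:: (u, v)]; rewrite !big_seq1/= /subitv/= au uv vb; move/(_ isT isT vud).
  by move=> /le_lt_trans; apply; rewrite ltry.
have ind n x : a <= x -> x <= b -> x - a <= n%:R * (d / 2) -> TV a x f \is a fin_num.
  elim: n x => [|n ih] x ax xb.
    rewrite mul0r subr_le0 => xa; have -> : x = a by apply/le_anti; rewrite xa.
    by rewrite total_variationxx.
  move=> xan; have [xad|dxa] := ltP (x - a) (d / 2).
    by apply: step => //; lra.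
  have d2 : 0 < d / 2 by lra.
  rewrite (@total_variationD _ _ _ (x - d / 2)); [|lra..].
  rewrite fin_numD ih ?step//; try lra.
move=> x /andP[ax xb]; apply: (ind (Num.truncn ((x - a) / (d / 2))).+1) => //.
by rewrite -ler_pdivrMr ?divr_gt0// ltW// truncnS_gt.
Qed.

Lemma fine_total_variationB a b f x y : abs_continuous_seq a b f ->
  a <= x -> x <= y -> y <= b ->
  (fine (TV a y f) - fine (TV a x f))%:E = TV x y f.
Proof.
move=> acf ax xy yb; have ay := le_trans ax xy; have xb := le_trans xy yb.
have fx : TV a x f \is a fin_num by apply: (abs_continuous_TV_fin _ _ _ acf); rewrite ax.
have fy : TV a y f \is a fin_num by apply: (abs_continuous_TV_fin _ _ _ acf); rewrite ay.
by rewrite EFinB !fineK// (total_variationD f ax xy) addeAC subee// add0e.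
Qed.

(** The increment of the variation function over a piece is the variation of [f] on that piece, and
    sums of such variations are already known to be small. *)
Lemma abs_continuous_total_variation a b f : abs_continuous_seq a b f ->
  abs_continuous_seq a b (fun x => fine (TV a x f)).
Proof.
move=> acf e e0; have [d d0 fd] := abs_continuous_TV_small _ _ _ _ e0 acf.
exists d => // s abs seps sd; rewrite -lee_fin -sumEFin.
apply: le_trans (fd s abs seps sd); rewrite big_seq [leRHS]big_seq; apply: lee_sum => p ps.
have /and3P[ap pp pb] := allP abs _ ps.
have TVE := fine_total_variationB _ _ _ _ _ acf ap pp pb.
by rewrite -TVE lee_fin ger0_norm// -lee_fin TVE total_variation_ge0.
Qed.

End AbsContinuousFamilies.

(** * Stieltjes measures of nondecreasing absolutely continuous functions *)

Section MonotoneAbsContinuous.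
Context {R : realType}.
Implicit Types (a b e d : R) (F : R -> R) (G : cumulative R R).

Notation mu := (@lebesgue_measure R).
Notation ls := lebesgue_stieltjes_measure.

(** A Stieltjes measure requires a function on the whole line, so [F] is extended by constants
    through clamping to [[a, b]]. Clamping is nondecreasing and 1-Lipschitz; right continuity is
    then absolute continuity tested on a single interval. *)
Lemma nondecreasing_abs_continuous_cumulative a b F : a < b ->
  {in `[a, b] &, nondecreasing_fun F} -> abs_continuous_seq a b F ->
  exists G, forall x, a <= x <= b -> G x = F x.
Proof.
move=> ab ndF acF; pose clamp x := Num.max a (Num.min b x).
have cab x : a <= clamp x <= b.
  by rewrite /clamp; case: (leP b x) => ?; case: (leP a b) => ?;
    case: (leP a x) => ?; apply/andP; split; lra.
have minle x y : x <= y ->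
    Num.min b x <= Num.min b y /\ Num.min b y - Num.min b x <= y - x.
  by move=> xy; case: (leP b x) => ?; case: (leP b y) => ?; split; lra.
have maxle x y : x <= y ->
    Num.max a x <= Num.max a y /\ Num.max a y - Num.max a x <= y - x.
  by move=> xy; case: (leP a x) => ?; case: (leP a y) => ?; split; lra.
have cle x y : x <= y -> clamp x <= clamp y /\ clamp y - clamp x <= y - x.
  by move=> /minle[/maxle[? h] h']; split=> //; exact: le_trans h h'.
pose G x := F (clamp x).
have ndG : nondecreasing G.
  by move=> x y /cle[cxy _]; apply: ndF; rewrite ?in_itv/= ?cab.
have rcG : forall x, G y @[y --> at_right x] --> G x.
  move=> x; apply/cvgrPdist_le => e e0; have [d d0 Fd] := acF _ e0.
  near=> y; have xy : x < y by near: y; exact: nbhs_right_gt.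
  have yd : y < x + d by near: y; apply: nbhs_right_lt; rewrite ltrDl.
  have [c1 c2] := cle _ _ (ltW xy).
  have := Fd [:: (clamp x, clamp y)]; rewrite !big_seq1/= /subitv/= distrC; apply => //.
    by have /andP[-> _] := cab x; have /andP[_ ->] := cab y; rewrite c1.
  by rewrite (le_lt_trans c2)// ltrBlDl.
pose GC : cumulative R R := HB.pack G (isCumulative.Build R _ R G ndG rcG).
exists GC => x xab; rewrite /= /G; congr F; rewrite /clamp.
by move/andP: xab => [ax xb]; case: (leP b x) => ?; case: (leP a b) => ?; case: (leP a x) => ?; lra.
Unshelve. all: by end_near. Qed.

Lemma lebesgue_stieltjes_ocitv G x y : x <= y ->
  ls G `]x, y]%classic = (G y - G x)%:E.
Proof.
move=> xy; rewrite /ls /measure_extension measurable_mu_extE/=; last exact: is_ocitv.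
by rewrite wlength_itv_bnd.
Qed.

(* [U] is the limit inferior of the unions [V n] of the cells of the [n]-th
   uniform grid that are contained in [U]. *)
Lemma lebesgue_stieltjes_open_le G a b e d (U : set R) : a < b ->
  oscillation_small a b G e d -> open U -> U `<=` `]a, b[ ->
  (mu U < d%:E)%E -> (ls G U <= e%:E)%E.
Proof.
move=> ab Gd oU Uab mUd.
pose grid n i := a + (b - a) * (i%:R / n.+1%:R).
have n0 n : 0 < n.+1%:R :> R by [].
have gridS n i : grid n i.+1 - grid n i = (b - a) / n.+1%:R.
  by rewrite /grid -(natr1 i); ring.
have gridSlt n i : grid n i < grid n i.+1.
  by rewrite -subr_gt0 gridS divr_gt0// subr_gt0.
have grid_le n i j : (i <= j)%N -> grid n i <= grid n j.
  by move=> ij; rewrite lerD2l ler_pM2l ?subr_gt0// ler_pM2r ?invr_gt0// ler_nat.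
have grid0 n : grid n 0%N = a by rewrite /grid mul0r mulr0 addr0.
have gridn n : grid n n.+1 = b by rewrite /grid divff// mulr1 addrC subrK.
pose cell n i : set (measurableTypeR R) := `]grid n i, grid n i.+1]%classic.
have mcell n i : measurable (cell n i) by exact: measurable_itv.
pose P n i := `[< cell n i `<=` U >].
pose V n : set (measurableTypeR R) := \big[setU/set0]_(i < n.+1 | P n i) cell n i.
have mV n : measurable (V n) by apply: bigsetU_measurable => *.
have VU n : V n `<=` U.
  rewrite /V; elim/big_ind : _ => //; first by move=> A B AU BU x [/AU|/BU].
  by move=> i /asboolP.
have cell_triv n : trivIset [set: 'I_n.+1] (fun i : 'I_n.+1 => cell n i).
  apply/trivIsetP => i j _ _ ij.
  wlog lij : i j ij / (i < j)%N.
    move=> wl; have [/wl->//|ji|/ord_inj/eqP] := ltngtP i j; last by rewrite (negbTE ij).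
    by rewrite setIC wl// eq_sym.
  apply/seteqP; split => // x []; rewrite /cell/= !in_itv/= => /andP[_ xi] /andP[jx _].
  by have := lt_le_trans jx xi; rewrite ltNge grid_le.
have muV n : mu (V n) = (\sum_(i < n.+1 | P n i) (grid n i.+1 - grid n i))%:E.
  rewrite /V -sumEFin measure_bigsetU_ord//.
  apply: eq_bigr => i _.
  by have /= -> := @lebesgue_measure_itv R `]grid n i, grid n i.+1]; rewrite lte_fin gridSlt.
have lsV n : (ls G (V n) <= e%:E)%E.
  have -> : ls G (V n) = (\sum_(i < n.+1 | P n i) (G (grid n i.+1) - G (grid n i)))%:E.
    rewrite /V -sumEFin measure_bigsetU_ord//.
    by apply: eq_bigr => i _; exact/lebesgue_stieltjes_ocitv/ltW.
  (* The selected cells form a separated family whose total length is [mu (V n)], at most [mu U],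
     hence below [d]. *)
  pose s := [seq (grid n (val i), grid n (val i).+1)
    | i <- [seq i : 'I_n.+1 <- enum 'I_n.+1 | P n i]].
  have sE (H : R * R -> R) :
      \sum_(p <- s) H p = \sum_(i < n.+1 | P n i) H (grid n i, grid n i.+1).
    by rewrite big_map big_filter big_enum_cond.
  rewrite lee_fin; have := Gd s; rewrite !sE/=.
  move=> Gds; apply: le_trans (Gds _ _ _).
  - by apply: ler_sum => i _; rewrite ler_norm.
  - apply/allP => p /mapP[i _ ->]; rewrite /subitv/= (ltW (gridSlt _ _)).
    by rewrite -{1}(grid0 n) grid_le//= -(gridn n) grid_le.
  - rewrite pairwise_map; apply: (@sub_pairwise _ (relpre val ltn)).
      by move=> i j ij; rewrite /separated/= grid_le.
    apply: pairwise_filter; rewrite -(pairwise_map val) val_enum_ord.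
    by rewrite -sorted_pairwise ?iota_ltn_sorted//; exact: ltn_trans.
  - by rewrite -lte_fin -muV; apply: le_lt_trans mUd; apply: le_measure; rewrite ?inE//;
      exact: measurable_realfun.open_measurable.
(* Successive grids are not nested, so [V n] need not increase with [n]. The tail intersections
   [W n] do, and continuity from below applies to them. *)
pose W n : set (measurableTypeR R) := \bigcap_(m in [set m | (n <= m)%N]) V m.
have mW n : measurable (W n) by apply: bigcap_measurable => //; exists n => /=.
have lsW n : (ls G (W n) <= e%:E)%E.
  by apply: le_trans (lsV n); apply: le_measure; rewrite ?inE//; apply: bigcap_inf => /=.
have UW : U `<=` \bigcup_n W n.
  move=> x Ux; have /= := Uab _ Ux; rewrite in_itv/= => /andP[ax xb].
  have /nbhs_ballP[r /= r0 xrU] := open_nbhs_nbhs (conj oU Ux).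
  (* From grid [N] on, cells are shorter than [r], so the cell containing [x] lies in the ball of
     radius [r], hence in [U]. Its index is the least [i] with [x <= grid m i.+1]. *)
  pose N := Num.truncn ((b - a) / r); exists N => // m /= Nm.
  have small : (b - a) / m.+1%:R < r.
    rewrite ltr_pdivrMr// mulrC -ltr_pdivrMr//.
    by apply: lt_le_trans (truncnS_gt _) _; rewrite ler_nat.
  have ex : exists i, x <= grid m i.+1 by exists m; rewrite gridn ltW.
  pose i := ex_minn ex.
  have [xi imin] : x <= grid m i.+1 /\ forall j, x <= grid m j.+1 -> (i <= j)%N.
    by rewrite /i; case: ex_minnP.
  clearbody i; rewrite -(gridS m i) in small.
  have im : (i < m.+1)%N by rewrite ltnS imin// gridn ltW.
  have ix : grid m i < x.
    case: (i) imin => [|j] imin; first by rewrite grid0.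
    by rewrite ltNge; apply/negP => /imin; rewrite ltnn.
  have cellx : cell m i x by rewrite /cell/= in_itv/= ix.
  have Pi : P m i.
    apply/asboolP => y; rewrite /cell/= in_itv/= => /andP[iy yi]; apply: xrU => /=.
    by rewrite -ball_normE /ball_ /= ltr_norml; apply/andP; split; lra.
  by rewrite /V (bigD1 (Ordinal im))//=; left.
have mUW : measurable (\bigcup_n W n) by exact: bigcup_measurable.
apply: (@le_trans _ _ (ls G (\bigcup_n W n))).
  by apply: le_measure; rewrite ?inE//; exact: measurable_realfun.open_measurable.
have ndW : nondecreasing_seq W.
  by move=> n m nm; apply/subsetPset => x Wx k /= mk; apply: Wx => /=; exact: leq_trans mk.
have cW := nondecreasing_cvg_mu (mu := ls G) mW mUW ndW.
rewrite -(cvg_lim _ cW)//; apply: lime_le; first by apply/cvg_ex; eexists; exact: cW.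
by apply: nearW => n; exact: lsW.
Qed.

(** The density comes from the Radon-Nikodym theorem. By outer regularity a null set lies in an open
    set of measure below [d], whose Stieltjes measure is then at most [e]; this gives domination.
    The measure is restricted to []a, b[], hence the condition [x < b]. *)
Lemma nondecreasing_abs_continuous_density a b F : a < b ->
  {in `[a, b] &, nondecreasing_fun F} -> abs_continuous_seq a b F ->
  exists2 g : R -> R, mu.-integrable setT (EFin \o g) &
    forall x, a <= x < b -> (F x - F a)%:E = (\int[mu]_(t in `]a, x]) (g t)%:E)%E.
Proof.
move=> ab ndF acF.
have [G GF] := nondecreasing_abs_continuous_cumulative _ _ _ ab ndF acF.
have acG : abs_continuous_seq a b G.
  move=> e e0; have [d d0 Fd] := acF _ e0; exists d => // s abs seps sd.
  apply: le_trans (Fd s abs seps sd); rewrite big_seq [leRHS]big_seq.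
  apply: ler_sum => p ps; have /and3P[ap pp pb] := allP abs _ ps.
  by rewrite !GF// ?ap ?pb ?(le_trans ap) ?(le_trans pp).
pose D : set (measurableTypeR R) := `]a, b[%classic.
have mD : measurable D by exact: measurable_itv.
have Doo : (ls G D < +oo)%E.
  apply: (@le_lt_trans _ _ (ls G `]a, b]%classic)).
    by apply: le_measure; rewrite ?inE//; exact: subset_itv_oo_oc.
  by rewrite lebesgue_stieltjes_ocitv ?ltry// ltW.
pose nu : {finite_measure set (measurableTypeR R) -> \bar R} := mfrestr mD Doo.
have dom : nu `<< mu.
  apply/null_content_dominatesP => A mA mA0.
  change (ls G (A `&` D) = 0); apply/le_anti; rewrite measure_ge0 andbT.
  apply/lee_addgt0Pr => e e0; rewrite add0e.
  have mAD : measurable (A `&` D) by exact: measurableI.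
  have mAD0 : mu (A `&` D) = 0.
    apply/le_anti; rewrite measure_ge0 andbT -mA0.
    by apply: le_measure; rewrite ?inE.
  have ADoo : (mu (A `&` D) < +oo)%E by rewrite mAD0 ltry.
  have [d d0 Gd] := acG _ e0.
  have [|U [oU ADU UAD]] := lebesgue_regularity_outer mAD _ d0; first exact: ADoo.
  have oUD : open (U `&` `]a, b[) by apply: openI => //; exact: interval_open.
  apply: le_trans (lebesgue_stieltjes_open_le _ _ _ _ _ (U `&` `]a, b[) ab Gd oUD _ _).
  - apply: le_measure; rewrite ?inE//; first exact: measurable_realfun.open_measurable.
    by move=> x ADx; split; [exact: ADU|case: ADx].
  - exact: subIsetr.
  - apply: le_lt_trans UAD; have mU : measurable U by exact: measurable_realfun.open_measurable.
    rewrite -[X in (_ <= X)%E]adde0 -mAD0; apply: le_trans (measureU2 _ _ _) => //.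
      apply: le_measure; rewrite ?inE//.
      - exact: measurable_realfun.open_measurable.
      - by apply: measurableU => //; exact: measurableD.
      - by move=> x [Ux _]; have [|] := pselect ((A `&` D) x); [right|left].
    exact: measurableD.
have [f [f0 ffin fint fE]] := radon_nikodym_sigma_finite dom.
have fE' : EFin \o (fine \o f) = f by apply/funext => x /=; rewrite fineK.
exists (fine \o f); first by rewrite fE'.
move=> x /andP[ax xb].
have -> : (\int[mu]_(t in `]a, x]) ((fine \o f) t)%:E = \int[mu]_(t in `]a, x]) f t)%E.
  by apply: eq_integral => t _; rewrite /= fineK.
rewrite -fE//; change (((F x - F a)%:E : \bar R) = ls G (`]a, x]%classic `&` D)).
rewrite setIidl; last first.
  move=> y; rewrite /D/= !in_itv/= => /andP[ay yx].
  by rewrite ay (le_lt_trans yx).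
by rewrite lebesgue_stieltjes_ocitv// !GF// ?lexx ?ax ltW.
Qed.

End MonotoneAbsContinuous.

(** * The fundamental theorem of calculus for absolutely continuous functions *)

Section AbsContinuousDerivative.
Context {R : realType}.
Implicit Types (a b : R) (f : R -> R).

Notation mu := (@lebesgue_measure R).

(** An increment of [f] is at most the corresponding increment of its variation [V], so [V \- f] is
    nondecreasing like [V]. The density of [f] is the difference of their two densities. *)
Lemma abs_continuous_density a b f : a < b -> abs_continuous_seq a b f ->
  exists2 g : R -> R, mu.-integrable setT (EFin \o g) &
    forall x, a <= x < b -> f x - f a = (\int[mu]_(t in `]a, x]) g t)%R.
Proof.
move=> ab acf; pose V x := fine (total_variation a x f).
have acV : abs_continuous_seq a b V by exact: abs_continuous_total_variation.
have TVE x y : a <= x -> x <= y -> y <= b ->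
    (V y - V x)%:E = total_variation x y f by exact: fine_total_variationB.
have ndV : {in `[a, b] &, nondecreasing_fun V}.
  move=> x y; rewrite !in_itv/= => /andP[ax _] /andP[_ yb] xy.
  by rewrite -subr_ge0 -lee_fin TVE// total_variation_ge0.
have ndN : {in `[a, b] &, nondecreasing_fun (V \- f)}.
  move=> x y; rewrite !in_itv/= => /andP[ax _] /andP[_ yb] xy.
  have : f y - f x <= V y - V x.
    by rewrite -lee_fin TVE// (le_trans _ (total_variation_ge f xy))// lee_fin ler_norm.
  by rewrite /=; lra.
have [v iv vE] := nondecreasing_abs_continuous_density _ _ _ ab ndV acV.
have [w iw wE] := nondecreasing_abs_continuous_density _ _ _ ab ndN
  (abs_continuous_seqB _ _ _ _ acV acf).
have iS (h : R -> R) x : mu.-integrable setT (EFin \o h) ->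
    mu.-integrable `]a, x] (EFin \o h) by exact: integrableS.
exists (v \- w); first by apply: eq_integrable (integrableB _ iv iw).
move=> x axb; rewrite RintegralB//; [|exact: iS..].
by rewrite /Rintegral -vE// -wE//= opprB addrCA; lra.
Qed.

(** Near an interior point [f] is [f a] plus the indefinite integral of [g], and the latter has
    derivative [g] almost everywhere by Lebesgue's differentiation theorem. *)
Lemma abs_continuous_derive a b f : a < b -> abs_continuous_seq a b f ->
  exists2 g : R -> R, mu.-integrable setT (EFin \o g) &
    (forall x, a <= x < b -> f x - f a = (\int[mu]_(t in `]a, x]) g t)%R) /\
    {ae mu, forall x, a < x < b -> derive1 f x = g x}.
Proof.
move=> ab acf; have [g ig gE] := abs_continuous_density _ _ _ ab acf.
exists g => //; split=> //.
have iS y : mu.-integrable [set` Interval (BRight a) (BRight y)] (EFin \o g).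
  exact: integrableS ig.
have := FTC1 iS (open_integrable_locally openT ig).
set F := (fun x => _); apply: filterS; first exact: (ae_filter_ringOfSetsType mu).
move=> x dF /andP[ax xb].
have [|dFx <-] := dF; first exact: ax.
rewrite !derive1E.
have -> : 'D_1 F x = 'D_1 (fun y => f a + F y) x.
  by rewrite deriveD// derive_cst add0r.
apply: near_eq_derive; near=> y.
rewrite /F -gE ?subrKC//.
by apply/andP; split; [apply/ltW; near: y; exact: lt_nbhsr|near: y; exact: lt_nbhsl].
Unshelve. all: by end_near. Qed.

End AbsContinuousDerivative.

(** * Integrals of nonmeasurable functions *)

Section LowerIntegral.
Local Open Scope ereal_scope.
Context d (T : measurableType d) (R : realType).
Variable mu : {measure set T -> \bar R}.
Implicit Types (D N : set T) (f g : T -> \bar R).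

Import HBNNSimple.

(** Together with its counterpart below, this reduces inequalities between lower integrals to simple
    functions, where the measurable theory is available. *)
Lemma ge0_integral_le_nnsfun D f (B : \bar R) : (forall x, D x -> 0 <= f x) ->
  (forall h : {nnsfun T >-> R}, (forall x, (h x)%:E <= (f \_ D) x) ->
    \int[mu]_x (h x)%:E <= B) ->
  \int[mu]_(x in D) f x <= B.
Proof.
move=> f0 hB; rewrite ge0_integralE//; apply: ge_ereal_sup => _ [h hf <-].
by rewrite -integralT_nnsfun; exact: hB.
Qed.

Lemma ge0_integral_ge_nnsfun D f (h : {nnsfun T >-> R}) :
  (forall x, D x -> 0 <= f x) -> (forall x, (h x)%:E <= (f \_ D) x) ->
  \int[mu]_x (h x)%:E <= \int[mu]_(x in D) f x.
Proof.
move=> f0 hf; rewrite [leRHS]ge0_integralE// integralT_nnsfun.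
by apply: ereal_sup_ubound; exists h.
Qed.

(* On a nonmeasurable function [integral] is a lower integral: it is monotone,
   but subadditive only if one of the two summands is measurable. *)
Lemma ge0_le_lower_integral D D' f g : D `<=` D' ->
  (forall x, D x -> 0 <= f x) -> (forall x, D' x -> 0 <= g x) ->
  (forall x, D x -> f x <= g x) ->
  \int[mu]_(x in D) f x <= \int[mu]_(x in D') g x.
Proof.
move=> DD' f0 g0 fg; apply: ge0_integral_le_nnsfun => // h hf.
apply: ge0_integral_ge_nnsfun => // x; apply: le_trans (hf x) _.
rewrite !patchE; case: ifPn => [/set_mem Dx|_]; first by rewrite mem_set ?fg//; exact: DD'.
by case: ifPn => // /set_mem; exact: g0.
Qed.

(** A simple function below [f] keeps its integral when it is set to zero on [N], and is then below
    [g]. *)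
Lemma ge0_ae_le_lower_integral D D' N f g : D `<=` D' ->
  (forall x, D x -> 0 <= f x) -> (forall x, D' x -> 0 <= g x) ->
  measurable N -> mu N = 0 -> (forall x, D x -> ~ N x -> f x <= g x) ->
  \int[mu]_(x in D) f x <= \int[mu]_(x in D') g x.
Proof.
move=> DD' f0 g0 mN N0 fg; apply: ge0_integral_le_nnsfun => // h hf.
rewrite (ge0_negligible_integral (N := N))//; last 2 first.
- exact/measurable_EFinP.
- by move=> x _; rewrite lee_fin.
have h0 x : 0 <= (h x)%:E by rewrite lee_fin.
rewrite setTD integral_mkcond [leRHS]integral_mkcond; apply: ge0_le_lower_integral => //.
- by move=> x _; apply: erestrict_ge0 => ? _.
- by move=> x _; exact: erestrict_ge0.
move=> x _; rewrite !patchE; case: ifPn => [/set_mem Nx|_].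
  apply: le_trans (hf x) _; rewrite patchE.
  case: ifPn => [/set_mem Dx|_]; first by rewrite mem_set ?fg//; exact: DD'.
  by case: ifPn => // /set_mem; exact: g0.
by case: ifPn => // /set_mem; exact: g0.
Qed.

(** If a simple [h] is below [f + g], the positive part of [h - g] is measurable and below [f].
    Since [h] is at most this positive part plus [g], additivity for measurable functions concludes.
    Finiteness of [g] makes the subtraction legitimate. *)
Lemma ge0_lower_integralD_le D f g : measurable D -> measurable_fun D g ->
  (forall x, D x -> 0 <= f x) -> (forall x, D x -> 0 <= g x) ->
  (forall x, D x -> g x \is a fin_num) ->
  \int[mu]_(x in D) (f x + g x) <= \int[mu]_(x in D) f x + \int[mu]_(x in D) g x.
Proof.
move=> mD mg f0 g0 gfin.
apply: ge0_integral_le_nnsfun => [x Dx|h hfg]; first by rewrite adde_ge0 ?f0 ?g0.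
pose k := g \_ D.
have k0 x : 0 <= k x by exact: erestrict_ge0.
have kfin x : k x \is a fin_num.
  by rewrite /k patchE; case: ifPn => // /set_mem; exact: gfin.
have mk : measurable_fun setT k by exact/(measurable_restrictT _ mD).
pose h' x := maxe ((h x)%:E - k x) 0.
have mh' : measurable_fun setT h'.
  apply: measurable_maxe => //; apply: emeasurable_funB => //.
  exact/measurable_EFinP.
have h'0 x : 0 <= h' x by rewrite le_max lexx orbT.
apply: (@le_trans _ _ (\int[mu]_x (h' x + k x))).
  apply: ge0_le_lower_integral => // x _; rewrite ?lee_fin ?adde_ge0//.
  by rewrite -leeBlDr// le_max lexx.
rewrite ge0_integralD// -(integral_mkcond D g); apply: leeD => //.
rewrite [leRHS]integral_mkcond; apply: ge0_le_lower_integral => // x _.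
  exact: erestrict_ge0.
rewrite ge_max erestrict_ge0// andbT leeBlDr//; apply: le_trans (hfg x) _.
by rewrite /k !patchE; case: ifP => //; rewrite adde0.
Qed.

Lemma ge0_lower_integralZ_le D f (c : R) : (0 < c)%R ->
  (forall x, D x -> 0 <= f x) ->
  \int[mu]_(x in D) (c%:E * f x) <= c%:E * \int[mu]_(x in D) f x.
Proof.
move=> c0 f0; have cf0 x : D x -> 0 <= c%:E * f x.
  by move=> Dx; rewrite mule_ge0 ?f0// lee_fin ltW.
apply: ge0_integral_le_nnsfun => // h hf.
have h0 x : 0 <= (c^-1 * h x)%:E by rewrite lee_fin mulr_ge0// invr_ge0 ltW.
have -> : \int[mu]_x (h x)%:E = c%:E * \int[mu]_x (c^-1 * h x)%:E.
  rewrite -ge0_integralZl_EFin//; last 2 first.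
  - by apply/measurable_EFinP; exact: measurable_funM.
  - exact: ltW.
  by apply: eq_integral => x _; rewrite -EFinM mulrA divff ?mul1r// gt_eqF.
rewrite lee_pmul2l//; rewrite [leRHS]integral_mkcond.
apply: ge0_le_lower_integral => // x _; first exact: erestrict_ge0.
have := hf x; rewrite !patchE; case: ifPn => [/set_mem Dx|_] hx.
  rewrite -(@lee_pmul2l _ c%:E)// -EFinM mulrA divff ?gt_eqF// mul1r.
  exact: hx.
by rewrite EFinM mule_ge0_le0// ?lee_fin ?invr_ge0 ?ltW.
Qed.

Lemma ge0_lower_integral_affine_le D f (c k : R) : measurable D ->
  (0 < c)%R -> (0 <= k)%R -> (forall x, D x -> 0 <= f x) ->
  \int[mu]_(x in D) (c%:E * f x + k%:E) <=
    c%:E * \int[mu]_(x in D) f x + k%:E * mu D.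
Proof.
move=> mD c0 k0 f0; apply: le_trans (ge0_lower_integralD_le _ _ _ mD _ _ _ _) _ => //.
- by move=> x Dx; rewrite mule_ge0 ?f0// lee_fin ltW.
- by rewrite integral_cst// leeD2r// ge0_lower_integralZ_le.
Qed.

End LowerIntegral.

(** * The estimate on a slice *)

Section Slice.
Context {R : realType}.
Implicit Types (a b w r : R) (f : R -> R).

Notation mu := (@lebesgue_measure R).

Lemma integral_itv_derive (f F : R -> R) a b : a < b ->
  (forall x, a <= x <= b -> is_derive x 1 F (f x)) ->
  (forall x, a <= x <= b -> {for x, continuous f}) ->
  (\int[mu]_(x in `[a, b]) (f x)%:E = (F b - F a)%:E)%E.
Proof.
move=> ab dF cf; have cF x : a <= x <= b -> {for x, continuous F}.
  by move=> /dF[dFx _]; apply: differentiable_continuous; exact/derivable1_diffP.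
rewrite (@continuous_FTC2 _ f F)//.
- apply/continuous_in_subspaceT => x; rewrite inE/= in_itv/=; exact: cf.
- split.
  + by move=> x; rewrite in_itv/= => /andP[ax xb]; have [] := dF x; rewrite ?(ltW ax) ?ltW.
  + by apply: cvg_at_right_filter; apply: cF; rewrite lexx ltW.
  + by apply: cvg_at_left_filter; apply: cF; rewrite lexx ltW.
- move=> x; rewrite in_itv/= => /andP[ax xb].
  by rewrite derive1E; have [] := dF x; rewrite ?(ltW ax) ?ltW.
Qed.

Lemma integral_linear (c a : R) : 0 < a ->
  (\int[mu]_(x in `[0%R, a]) (c * x)%:E = (c * a ^+ 2 / 2)%:E)%E.
Proof.
move=> a0.
have dF x : 0 <= x <= a -> is_derive x 1 (fun x => c / 2 * x ^+ 2) (c * x).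
  move=> _; apply: is_derive_eq; rewrite /GRing.scale/=.
  by rewrite mulr1; lra.
have cf x : 0 <= x <= a -> {for x, continuous (fun x : R => c * x)}.
  by move=> _; apply: cvgM; [exact: cvg_cst|exact: cvg_id].
by rewrite (integral_itv_derive _ _ _ _ a0 dF cf); congr EFin; rewrite expr0n/=; lra.
Qed.

Lemma integral_inv (c a : R) : 0 < a -> a <= 1 ->
  (\int[mu]_(x in `[a, 1%R]) (c / x)%:E = (c * - ln a)%:E)%E.
Proof.
move=> a0; rewrite le_eqVlt => /predU1P[->|a1].
  by rewrite set_itv1 integral_set1 ln1 oppr0 mulr0.
have dF x : a <= x <= 1 -> is_derive x 1 (fun x => c * ln x) (c / x).
  move=> /andP[ax _]; have x0 := lt_le_trans a0 ax.
  by have lnx := is_derive1_ln x0; apply: is_derive_eq; rewrite /GRing.scale/=; lra.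
have cf x : a <= x <= 1 -> {for x, continuous (fun x : R => c / x)}.
  move=> /andP[ax _]; have x0 := lt_le_trans a0 ax.
  by apply: cvgM; [exact: cvg_cst|apply: cvgV; [rewrite gt_eqF|exact: cvg_id]].
by rewrite (integral_itv_derive _ _ _ _ a1 dF cf) ln1; congr EFin; lra.
Qed.

Definition slice_energy f : \bar R :=
  (\int[mu]_(r in `]0%R, 1%R[) (`|derive1 f r| ^+ 2 / r)%:E)%E.

Lemma slice_energy_ge0 f : (0 <= slice_energy f)%E.
Proof.
apply: integral_ge0 => r /=; rewrite in_itv/= => /andP[r0 _].
by rewrite lee_fin divr_ge0// ?exprn_ge0// ltW.
Qed.

(* AM-GM: [|f'| <= c s / 2 + |f'| ^ 2 / (2 c s)], integrated in [s]. *)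
Lemma slice_increment_le f (E c x r : R) : locally_abs_continuous01 f ->
  slice_energy f = E%:E -> 0 < c -> 0 < x -> x < r -> r < 1 ->
  `|f r - f x| <= c * r ^+ 2 / 4 + E / (2 * c).
Proof.
(* The integral formula holds strictly below the right endpoint, so that endpoint is placed between
   [r] and 1. *)
move=> acf fE c0 x0 xr r1; pose b := (r + 1) / 2.
have rb : r < b by rewrite /b; lra.
have b1 : b < 1 by rewrite /b; lra.
have xb : x < b by exact: lt_trans rb.
have acb := abs_continuous_itv_seq _ _ _ (acf x b x0 (ltW xb) b1).
have [g ig [gE [N [mN N0 fg]]]] := abs_continuous_derive _ _ _ xb acb.
have mxr : measurable (`]x, r] : set (measurableTypeR R)) by exact: measurable_itv.
have igx : mu.-integrable `]x, r] (EFin \o g) by exact: integrableS ig.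
have mg : measurable_fun (`]x, r] : set (measurableTypeR R)) g.
  by have /measurable_int/measurable_EFinP := igx.
rewrite gE ?(ltW xr)//.
apply: le_trans (le_normr_Rintegral _ igx) _ => //.
rewrite -lee_fin /Rintegral fineK; last first.
  by apply: integrable_fin_num => //; exact: (integrable_norm igx).
have s0 s : s \in `]x, r] -> 0 < s by rewrite in_itv/= => /andP[xs _]; exact: lt_trans xs.
pose q s := `|g s| ^+ 2 / s.
have q0 s : s \in `]x, r] -> 0 <= q s.
  by move=> /s0 s0'; rewrite divr_ge0 ?exprn_ge0// ltW.
have qE0 s : `]x, r]%classic s -> (0 <= (q s)%:E)%E by move=> /q0; rewrite lee_fin.
(* The majorant exceeds [|g s|] by a square divided by [2 * c * s]. The linear term comes second
   because subadditivity asks for measurability of the second summand. *)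
apply: (@le_trans _ _ (\int[mu]_(s in `]x, r])
    (((2 * c)^-1)%:E * (q s)%:E + (c / 2 * s)%:E))%E).
  apply: ge0_le_lower_integral => // s sxr; have s0' := s0 _ sxr.
    rewrite -EFinM -EFinD lee_fin addr_ge0// mulr_ge0 ?q0// ?invr_ge0; lra.
  rewrite -EFinM -EFinD lee_fin /q.
  have -> : (2 * c)^-1 * (`|g s| ^+ 2 / s) + c / 2 * s =
      `|g s| + (`|g s| - c * s) ^+ 2 / (2 * c * s) by field; rewrite !gt_eqF.
  by rewrite lerDl divr_ge0 ?sqr_ge0// !mulr_ge0// ltW.
apply: le_trans (ge0_lower_integralD_le _ _ _ _ _ _ _ _ _ _ _ _) _ => //.
- by apply/measurable_EFinP; exact: measurable_funM.
- by move=> s sxr; rewrite -EFinM lee_fin mulr_ge0 ?q0// invr_ge0; lra.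
- by move=> s /s0 s0'; rewrite lee_fin mulr_ge0 ?divr_ge0 ?ltW.
rewrite EFinD addeC; apply: leeD.
  have -> : c * r ^+ 2 / 4 = c / 2 * r ^+ 2 / 2 by lra.
  rewrite -integral_linear ?(lt_trans x0)//; apply: ge0_le_lower_integral => //.
  - by move=> s /=; rewrite !in_itv/= => /andP[xs ->]; rewrite (ltW (lt_trans x0 xs)).
  - by move=> s /s0 s0'; rewrite lee_fin mulr_ge0 ?divr_ge0 ?ltW.
  - move=> s /=; rewrite in_itv/= => /andP[s0' _]; rewrite lee_fin mulr_ge0 ?divr_ge0//; lra.
apply: le_trans (ge0_lower_integralZ_le _ _ _ _ _ _ _ _ _) _.
- by rewrite invr_gt0; lra.
- exact: qE0.
have -> : E / (2 * c) = (2 * c)^-1 * E by rewrite mulrC.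
rewrite EFinM lee_pmul2l//; last by rewrite lte_fin invr_gt0; lra.
(* Here [g] is replaced by the derivative of [f] off the null set [N], and []x, r]] is enlarged to
   []0, 1[]. *)
rewrite -fE; apply: (ge0_ae_le_lower_integral _ _ _ _ _ _ N) => //.
- by move=> s /=; rewrite !in_itv/= => /andP[xs sr]; rewrite (lt_trans x0 xs) (le_lt_trans sr).
- move=> s /=; rewrite in_itv/= => /andP[s0' _].
  by rewrite lee_fin divr_ge0 ?exprn_ge0// ltW.
- move=> s /=; rewrite in_itv/= => /andP[xs sr] Ns; rewrite lee_fin /q.
  have -> // : derive1 f s = g s.
  apply: contrapT => fgs; apply: Ns; apply: fg => /= h; apply: fgs; apply: h.
  by rewrite xs (le_lt_trans sr).
Qed.

(** As [x] decreases to 0, the increment bound becomes a bound on [|f r|] valid for every [c > 0],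
    in which [c] is then chosen. *)
Lemma slice_sqr_le f (E r : R) : locally_abs_continuous01 f ->
  f x @[x --> 0^'+] --> (0 : R) -> slice_energy f = E%:E -> 0 < r -> r < 1 ->
  f r ^+ 2 <= E / 2 * r ^+ 2.
Proof.
move=> acf f0 fE r0 r1.
have bound c : 0 < c -> `|f r| <= c * r ^+ 2 / 4 + E / (2 * c).
  move=> c0; apply/ler_addgt0Pr => e e0.
  near (0 : R)^'+ => x.
  have fx : `|f x| <= e.
    by near: x; move/cvgrPdist_le : f0 => /(_ _ e0); apply: filterS => x; rewrite sub0r normrN.
  have x0 : 0 < x by near: x; exact: nbhs_right_gt.
  have xr : x < r by near: x; exact: nbhs_right_lt.
  have := slice_increment_le _ _ _ _ _ acf fE c0 x0 xr r1.
  by have := ler_normD (f r - f x) (f x); rewrite subrK; lra.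
have E0 : 0 <= E by rewrite -lee_fin -fE slice_energy_ge0.
have [->|fr0] := eqVneq (f r) 0; first by rewrite expr0n/= mulr_ge0 ?divr_ge0 ?sqr_ge0.
have y0 : 0 < `|f r| by rewrite normr_gt0.
(* This [c] makes the first term [|f r| / 2], which is absorbed on the left. Unlike the minimizing
   value it involves no square root, and it is positive even if [E = 0]. *)
have := bound (2 * `|f r| / r ^+ 2); rewrite -[f r ^+ 2]real_normK ?num_real//.
set y := `|f r| in y0 *.
have c0 : 0 < 2 * y / r ^+ 2 by rewrite divr_gt0 ?mulr_gt0 ?exprn_gt0.
move=> /(_ c0).
have -> : 2 * y / r ^+ 2 * r ^+ 2 / 4 + E / (2 * (2 * y / r ^+ 2)) =
    y / 2 + E / 4 * r ^+ 2 / y by field; rewrite !gt_eqF.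
rewrite -lerBlDl ler_pdivlMr// => h; rewrite expr2; lra.
Unshelve. all: by end_near. Qed.

Lemma slice_inequality f w a : locally_abs_continuous01 f ->
  f x @[x --> 0^'+] --> (0 : R) -> (forall r, 0 < r < 1 -> `|f r| <= w) ->
  0 < a -> a <= 1 ->
  (\int[mu]_(r in `]0%R, 1%R[) (f r ^+ 2 / r)%:E <=
    (a ^+ 2 / 4)%:E * slice_energy f + (w ^+ 2 * - ln a)%:E)%E.
Proof.
move=> acf f0 fw a0 a1.
have a40 : 0 < a ^+ 2 / 4 by rewrite divr_gt0 ?exprn_gt0.
(* Infinite energy makes the right-hand side infinite, because [a] is positive. *)
case fE : (slice_energy f) (slice_energy_ge0 f) => [E| |]//; last first.
  by move=> _; rewrite gt0_muley ?lte_fin// addye// leey.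
rewrite lee_fin => E0.
(* The majorant [u] serves up to radius [a] and integrates to [E * a ^+ 2 / 4]; [k] serves from [a]
   on and integrates to [w ^+ 2 * - ln a]. *)
pose u : R -> \bar R := (fun r => (E / 2 * r)%:E) \_ `[0, a].
pose k : R -> \bar R := (fun r => (w ^+ 2 / r)%:E) \_ `[a, 1].
have m01 : measurable (`]0, 1[ : set (measurableTypeR R)) by exact: measurable_itv.
have u0 r : (0 <= u r)%E.
  apply: erestrict_ge0 => s /=; rewrite in_itv/= => /andP[s0 _].
  by rewrite lee_fin mulr_ge0// divr_ge0.
have k0 r : (0 <= k r)%E.
  apply: erestrict_ge0 => s /=; rewrite in_itv/= => /andP[/(lt_le_trans a0) s0 _].
  by rewrite lee_fin divr_ge0 ?sqr_ge0 ?ltW.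
have mk : measurable_fun (`]0, 1[ : set (measurableTypeR R)) k.
  apply: measurable_funTS.
  have ma1 : measurable (`[a, 1] : set (measurableTypeR R)) by exact: measurable_itv.
  apply/(measurable_restrictT _ ma1)/measurable_EFinP.
  apply: subspace_continuous_measurable_fun => //.
  apply: continuous_in_subspaceT => r; rewrite inE/= in_itv/= => /andP[ar _].
  apply: cvgM; first exact: cvg_cst.
  by apply: cvgV; [rewrite gt_eqF// (lt_le_trans a0)|exact: cvg_id].
apply: (@le_trans _ _ (\int[mu]_(r in `]0%R, 1%R[) (u r + k r))%E).
  apply: ge0_le_lower_integral => // r /=; rewrite in_itv/= => /andP[r0 r1].
  - by rewrite lee_fin divr_ge0 ?sqr_ge0 ?ltW.
  - by rewrite adde_ge0.
  have [ra|ar] := leP r a.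
    apply: le_trans (leeDl _ (k0 _)); rewrite /u patchE mem_set/=; last by rewrite in_itv/= ltW.
    by rewrite lee_fin ler_pdivrMr// -[_ * r * r]mulrA -expr2; exact: slice_sqr_le.
  apply: le_trans (leeDr _ (u0 _)); rewrite /k patchE mem_set/=; last by rewrite in_itv/= !ltW.
  rewrite lee_fin ler_pM2r ?invr_gt0// -[f r ^+ 2]real_normK ?num_real//.
  by rewrite lerXn2r ?nnegrE ?(le_trans (normr_ge0 (f r))) ?fw ?r0.
apply: le_trans (ge0_lower_integralD_le _ _ _ _ _ _ _ _ _ _ _ _) _ => //.
  by move=> r _; rewrite /k patchE; case: ifP.
apply: leeD.
  have -> : ((a ^+ 2 / 4)%:E * E%:E = (E / 2 * a ^+ 2 / 2)%:E)%E.
    by rewrite -EFinM; congr EFin; lra.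
  rewrite -integral_linear// [leRHS]integral_mkcond -/u.
  exact: ge0_le_lower_integral.
rewrite -integral_inv// [leRHS]integral_mkcond -/k.
exact: ge0_le_lower_integral.
Qed.

End Slice.

(** * Integration over the slices *)

Section CirculationEstimate.
Context {R : realType}.
Implicit Types (I Z : set R) (w a c : R) (G : R -> R -> R -> R).

Notation mu := (@lebesgue_measure R).

Lemma bounded_interval_finite I : is_interval I -> bounded_set I ->
  measurable (I : set (measurableTypeR R)) /\ (mu I < +oo)%E.
Proof.
move=> itvI [M [_ /(_ (M + 1))]]; rewrite ltrDl ltr01 => /(_ isT) IM.
have mI := is_interval_measurable itvI; split=> //.
apply: (@le_lt_trans _ _ (mu `[- (M + 1), M + 1]%classic)).
  apply: le_measure; rewrite ?inE//.
  by move=> x /IM /=; rewrite in_itv/= ler_norml.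
by rewrite lebesgue_measure_itv/= -EFinB -(fun_if EFin) ltry.
Qed.

(** By Tonelli the measures of the sections integrate to zero, so almost all of them vanish. *)
Lemma null_ysection (N : set (measurableTypeR R * measurableTypeR R)) :
  measurable N -> (mu \x mu)%E N = 0%E ->
  exists N' : set (measurableTypeR R), [/\ measurable N', mu N' = 0%E &
    forall t, ~ N' t -> mu (ysection N t) = 0%E].
Proof.
move=> mN N0.
have mG := measurable_fun_ysection mu mN.
have : (\int[mu]_t `|mu (ysection N t)| = 0)%E.
  under eq_integral do rewrite gee0_abs//.
  have := indic_fubini_tonelli mu mu mN.
  rewrite indic_fubini_tonelli_GE// indic_fubini_tonelli_FE// => <-; exact: N0.
move=> /(ae_eq_integral_abs mu measurableT mG)[N' [mN' N'0 sub]].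
exists N'; split=> // t N't; apply: contrapT => h; apply: N't; apply: sub => /= h'.
by apply: h; exact: h'.
Qed.

Lemma energy_slice Z I G : energy Z I G =
  (\int[mu]_(t in I) \int[mu]_(z in Z) slice_energy (fun r => G r z t))%E.
Proof. by []. Qed.

Lemma energy_ge0 Z I G : (0 <= energy Z I G)%E.
Proof.
rewrite energy_slice; apply: integral_ge0 => t _; apply: integral_ge0 => z _.
exact: slice_energy_ge0.
Qed.

(** The slice inequality is affine in the slice energy, with coefficients independent of [z] and
    [t], so it can be integrated in [z] and then in [t]. The exceptional set of the plane becomes a
    null set [N'] of times and, for every other time, a null section in [z]. *)
Lemma circulation_estimate Z I w G a :
  measurable (I : set (measurableTypeR R)) -> (mu I < +oo)%E ->
  measurable (Z : set (measurableTypeR R)) -> (mu Z < +oo)%E ->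
  circulation Z I G -> bounded_circulation Z I w G -> 0 < a -> a <= 1 ->
  (integral3 Z I (fun r z t => G r z t ^+ 2 / r)%R <=
    (a ^+ 2 / 4)%:E * energy Z I G +
    (length I * length Z * w ^+ 2 * - ln a)%:E)%E.
Proof.
move=> mI Ioo mZ Zoo [_ [N [mN N0 Ngood]]] Gw a0 a1.
have [N' [mN' N'0 N'sec]] := null_ysection _ mN N0.
have a40 : 0 < a ^+ 2 / 4 by rewrite divr_gt0 ?exprn_gt0.
have k0 : 0 <= w ^+ 2 * - ln a by rewrite mulr_ge0 ?sqr_ge0// oppr_ge0 ln_le0.
have Z0 : 0 <= length Z by rewrite fine_ge0.
have ZE : mu Z = (length Z)%:E by rewrite fineK// ge0_fin_numE.
have IE : mu I = (length I)%:E by rewrite fineK// ge0_fin_numE.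
have S0 z t : (0 <= \int[mu]_(r in `]0%R, 1%R[) (G r z t ^+ 2 / r)%:E)%E.
  apply: integral_ge0 => r /=; rewrite in_itv/= => /andP[r0 _].
  by rewrite lee_fin divr_ge0 ?sqr_ge0 ?ltW.
have e0 z t := slice_energy_ge0 (fun r => G r z t).
have Zslice t : I t -> ~ N' t ->
    (\int[mu]_(z in Z) \int[mu]_(r in `]0%R, 1%R[) (G r z t ^+ 2 / r)%:E <=
      (a ^+ 2 / 4)%:E * \int[mu]_(z in Z) slice_energy (fun r => G r z t) +
      (w ^+ 2 * - ln a * length Z)%:E)%E.
  move=> It N't; rewrite [(_ * length Z)%:E]EFinM -ZE.
  apply: le_trans (ge0_lower_integral_affine_le _ _ _ _ _ _ _ _ mZ a40 k0 _) => //.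
  apply: (ge0_ae_le_lower_integral _ _ _ _ _ _ (ysection N t)) => //.
  - by move=> z _; apply: adde_ge0 => //; apply: mule_ge0 => //; rewrite lee_fin ltW.
  - exact: measurable_ysection.
  - exact: N'sec.
  - move=> z Zz Nz.
    have [acG G0] : locally_abs_continuous01 (fun r => G r z t) /\
        G r z t @[r --> 0^'+] --> (0 : R).
      apply: contrapT => h; apply: Nz; rewrite /ysection/= inE.
      by apply: Ngood => /= /(_ Zz It).
    by apply: slice_inequality => // r r01; exact: Gw.
rewrite energy_slice.
have -> : length I * length Z * w ^+ 2 * - ln a = w ^+ 2 * - ln a * length Z * length I.
  by ring.
rewrite [(_ * length I)%:E]EFinM -IE.
apply: le_trans (ge0_lower_integral_affine_le _ _ _ _ _ _ _ _ mI a40 _ _) => //.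
- apply: (ge0_ae_le_lower_integral _ _ _ _ _ _ N') => //.
  + by move=> t _; apply: integral_ge0.
  + move=> t _; apply: adde_ge0; last by rewrite lee_fin mulr_ge0.
    by apply: mule_ge0; [rewrite lee_fin ltW|exact: integral_ge0].
- by rewrite mulr_ge0.
- by move=> t _; apply: integral_ge0.
Qed.

(* The choice [a ^ 2 = 1 / c] of the splitting radius. *)
Lemma circulation_estimate_weight Z I w G (E c : R) :
  measurable (I : set (measurableTypeR R)) -> (mu I < +oo)%E ->
  measurable (Z : set (measurableTypeR R)) -> (mu Z < +oo)%E ->
  circulation Z I G -> bounded_circulation Z I w G -> energy Z I G = E%:E ->
  1 <= c ->
  (integral3 Z I (fun r z t => G r z t ^+ 2 / r)%R <=
    (E / (4 * c) + length I * length Z * w ^+ 2 * (ln c / 2))%:E)%E.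
Proof.
move=> mI Ioo mZ Zoo circG Gw GE c1; have c0 : 0 < c by exact: lt_le_trans c1.
(* This is [c] to the power -1/2, written so that its logarithm is immediate; [a <= 1] comes from
   [1 <= c]. *)
pose a := expR (- (ln c / 2)).
have a0 : 0 < a := expR_gt0 _.
have a1 : a <= 1 by rewrite expR_le1 oppr_le0 divr_ge0// ln_ge0.
have := circulation_estimate _ _ _ _ _ mI Ioo mZ Zoo circG Gw a0 a1.
have a2 : a ^+ 2 = c^-1.
  by rewrite expr2 -expRD -opprD -splitr expRN lnK.
rewrite GE a2 /a expRK opprK -EFinM -EFinD.
have -> // : c^-1 / 4 * E = E / (4 * c) by field; rewrite gt_eqF.
Qed.

(** * Degenerate cases and the two final estimates *)

Lemma integral3_eq0 Z I (h : R -> R -> R -> R) :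
  (forall r z t, 0 < r < 1 -> Z z -> I t -> h r z t = 0) ->
  integral3 Z I h = 0%E.
Proof.
move=> h0; apply: integral0_eq => t It; apply: integral0_eq => z Zz.
by apply: integral0_eq => r /=; rewrite in_itv/= => r01; rewrite h0.
Qed.

(** This covers an interval of length zero, where the bound to be proved is itself zero. *)
Lemma integral3_null Z I (h : R -> R -> R -> R) :
  measurable (I : set (measurableTypeR R)) -> measurable (Z : set (measurableTypeR R)) ->
  (forall r z t, 0 < r < 1 -> 0 <= h r z t) ->
  mu I = 0%E \/ mu Z = 0%E -> (integral3 Z I h <= 0)%E.
Proof.
move=> mI mZ h0 IZ0.
have hr0 z t : (0 <= \int[mu]_(r in `]0%R, 1%R[) (h r z t)%:E)%E.
  by apply: integral_ge0 => r /=; rewrite in_itv/= => r01; rewrite lee_fin h0.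
have hz0 t : (0 <= \int[mu]_(z in Z) \int[mu]_(r in `]0%R, 1%R[) (h r z t)%:E)%E.
  exact: integral_ge0.
have [I0|Z0] := IZ0.
  rewrite -(integral0 mu I).
  by apply: (ge0_ae_le_lower_integral _ _ _ _ _ _ (I : set (measurableTypeR R))).
rewrite -(integral0 mu I); apply: ge0_le_lower_integral => // t _.
rewrite -(integral0 mu Z).
by apply: (ge0_ae_le_lower_integral _ _ _ _ _ _ (Z : set (measurableTypeR R))).
Qed.

Lemma log1_EFin (E x : R) : 0 <= E -> 0 <= x ->
  log1 E%:E x = (ln (1 + E / x))%:E.
Proof.
by move=> E0 x0; rewrite /log1 -EFinM -EFinD lne_EFin// ltr_wpDr ?divr_ge0.
Qed.

Lemma log1_pinfty (x : R) : 0 < x -> log1 +oo x = +oo%E.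
Proof.
by move=> x0; rewrite /log1 gt0_mulye ?lte_fin ?invr_gt0// addey.
Qed.

Lemma bounded_circulation0 Z I G :
  bounded_circulation Z I 0 G ->
  integral3 Z I (fun r z t => G r z t ^+ 2 / r)%R = 0%E.
Proof.
move=> G0; apply: integral3_eq0 => r z t r01 Zz It.
have := G0 r z t r01 Zz It; rewrite normr_le0 => /eqP ->.
by rewrite expr0n/= mul0r.
Qed.

Lemma circulation_estimate_log Z I w G :
  measurable (I : set (measurableTypeR R)) -> (mu I < +oo)%E ->
  measurable (Z : set (measurableTypeR R)) -> (mu Z < +oo)%E ->
  circulation Z I G -> bounded_circulation Z I w G ->
  (integral3 Z I (fun r z t => G r z t ^+ 2 / r)%R <=
    (length I * length Z * w ^+ 2)%:E *
      ((1 / 4)%:E +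
       (1 / 2)%:E * log1 (energy Z I G) (length I * length Z * w ^+ 2)))%E.
Proof.
move=> mI Ioo mZ Zoo circG Gw; set L := length I * length Z.
have I0 : 0 <= length I by rewrite fine_ge0.
have Z0 : 0 <= length Z by rewrite fine_ge0.
have L0 : 0 <= L by rewrite mulr_ge0.
(* In the degenerate case the right-hand side is zero: either [w = 0] and the circulation vanishes,
   or one of the intervals is null. *)
have [Lw0|Lw0] := eqVneq (L * w ^+ 2) 0.
  rewrite Lw0 mul0e; move/eqP: Lw0; rewrite mulf_eq0 expf_eq0/= => /orP[|/eqP w0]; last first.
    by rewrite w0 in Gw; rewrite bounded_circulation0.
  rewrite mulf_eq0 => IZ0; apply: integral3_null => //.
    by move=> r z t /andP[r0 _]; rewrite divr_ge0 ?sqr_ge0 ?ltW.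
  have fineE A : (mu A < +oo)%E -> length A == 0 -> mu A = 0%E.
    by move=> Aoo /eqP A0; rewrite -[mu A]fineK ?ge0_fin_numE// -/(length A) A0.
  by case/orP : IZ0 => /fineE ->//; [left|right].
have x0 : 0 < L * w ^+ 2 by rewrite lt0r Lw0 mulr_ge0 ?sqr_ge0.
case GE : (energy Z I G) (energy_ge0 Z I G) => [E| |]// E0; last first.
  rewrite log1_pinfty// gt0_muley ?lte_fin// addey// gt0_muley ?lte_fin//.
  exact: leey.
rewrite lee_fin in E0; rewrite log1_EFin ?(ltW x0)//.
have c1 : 1 <= 1 + E / (L * w ^+ 2) by rewrite lerDl divr_ge0 ?(ltW x0).
apply: le_trans (circulation_estimate_weight _ _ _ _ _ _ mI Ioo mZ Zoo circG Gw GE c1) _.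
rewrite -/L -(EFinM (1 / 2)) -EFinD -EFinM lee_fin.
set x := L * w ^+ 2 in x0 c1 *; set c := 1 + E / x in c1 *.
have c0 : 0 < c by exact: lt_le_trans c1.
(* Written through [c], the energy term [E / (4 * c)] is [x / 4 - x / (4 * c)], at most [x / 4]:
   this is the constant 1/4. *)
have -> : E = x * (c - 1) by rewrite /c; field; rewrite gt_eqF.
have -> : x * (c - 1) / (4 * c) = x / 4 - x / (4 * c) by field; rewrite gt_eqF.
have : 0 <= x / (4 * c) by rewrite divr_ge0 ?(ltW x0)// mulr_ge0// ltW.
lra.
Qed.

(** The weight [1 + E / w ^+ 2] does not involve the lengths. The energy term is thus at most
    [w ^+ 2 / 4], which accounts for the 1 in [1 + M ^+ 2], and the lengths enter only through their
    product in front of the logarithm, at most [M ^+ 2]. *)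
Lemma circulation_estimate_uniform Z I w G (M : R) :
  measurable (I : set (measurableTypeR R)) -> (mu I <= M%:E)%E ->
  measurable (Z : set (measurableTypeR R)) -> (mu Z <= M%:E)%E ->
  circulation Z I G -> bounded_circulation Z I w G ->
  (integral3 Z I (fun r z t => G r z t ^+ 2 / r)%R <=
    (1 + M ^+ 2)%:E *
      ((w ^+ 2)%:E * (1 + log1 (energy Z I G) (w ^+ 2))))%E.
Proof.
move=> mI IM mZ ZM circG Gw.
have [w0|w0] := eqVneq w 0.
  by rewrite w0 in Gw *; rewrite bounded_circulation0// expr0n/= mul0e mule0.
have w20 : 0 < w ^+ 2 by rewrite exprn_even_gt0.
have Ioo : (mu I < +oo)%E by apply: le_lt_trans IM _; rewrite ltry.
have Zoo : (mu Z < +oo)%E by apply: le_lt_trans ZM _; rewrite ltry.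
have M20 : 0 < 1 + M ^+ 2 by rewrite ltr_wpDr ?sqr_ge0.
case GE : (energy Z I G) (energy_ge0 Z I G) => [E| |]// E0; last first.
  by rewrite log1_pinfty// addey// gt0_muley ?lte_fin// gt0_muley ?lte_fin// leey.
rewrite lee_fin in E0; rewrite log1_EFin ?(ltW w20)//.
have c1 : 1 <= 1 + E / w ^+ 2 by rewrite lerDl divr_ge0 ?(ltW w20).
apply: le_trans (circulation_estimate_weight _ _ _ _ _ _ mI Ioo mZ Zoo circG Gw GE c1) _.
rewrite -EFinD -!EFinM lee_fin.
have fineM A : (mu A <= M%:E)%E -> (mu A < +oo)%E -> 0 <= length A <= M.
  move=> AM Aoo; rewrite fine_ge0//= -lee_fin fineK// ge0_fin_numE//.
have /andP[I0 I1] := fineM _ IM Ioo; have /andP[Z0 Z1] := fineM _ ZM Zoo.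
have LM : length I * length Z <= M ^+ 2 by rewrite expr2 ler_pM.
set c := 1 + E / w ^+ 2 in c1 *.
have c0 : 0 < c by exact: lt_le_trans c1.
have lnc : 0 <= ln c by rewrite ln_ge0.
have -> : E = w ^+ 2 * (c - 1) by rewrite /c; field.
have -> : w ^+ 2 * (c - 1) / (4 * c) = w ^+ 2 / 4 - w ^+ 2 / (4 * c) by field; rewrite gt_eqF.
have h1 : 0 <= w ^+ 2 / (4 * c) by rewrite divr_ge0 ?sqr_ge0// mulr_ge0// ltW.
have h2 : length I * length Z * (w ^+ 2 * ln c) <= M ^+ 2 * (w ^+ 2 * ln c).
  by rewrite ler_wpM2r// mulr_ge0// sqr_ge0.
have h3 : 0 <= M ^+ 2 * w ^+ 2 by rewrite mulr_ge0 ?sqr_ge0.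
have h4 : 0 <= w ^+ 2 * ln c by rewrite mulr_ge0 ?sqr_ge0.
have h5 : 0 <= M ^+ 2 * (w ^+ 2 * ln c) by exact: mulr_ge0 (sqr_ge0 _) h4.
lra.
Qed.

Lemma integral_mu5_angular Z I G :
  integral_mu5 Z I (fun r z t => angular G r z t ^+ 2) =
  integral3 Z I (fun r z t => G r z t ^+ 2 / r).
Proof.
apply: eq_integral => t _; apply: eq_integral => z _; apply: eq_integral => r.
rewrite inE/= in_itv/= => /andP[r0 _]; congr EFin; rewrite /angular.
by field; rewrite gt_eqF.
Qed.

End CirculationEstimate.

Theorem proposition7p2 (R : realType) :
  (forall (I Z : set R) (w : R) (G : R -> R -> R -> R),
     is_interval I -> bounded_set I -> is_interval Z -> bounded_set Z ->
     circulation Z I G ->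
     bounded_circulation Z I w G ->
     let L := length I * length Z in
     let E := energy Z I G in
     (integral3 Z I (fun r z t => G r z t ^+ 2 / r)%R <=
        (L * w ^+ 2)%:E *
          ((1 / 4)%:E + (1 / 2)%:E * log1 E (L * w ^+ 2)))%E)
  /\
  (forall (I Z : nat -> set R) (w : nat -> R) (G : nat -> R -> R -> R -> R),
     (forall j, is_interval (I j) /\ is_interval (Z j)) ->
     (exists M : R, forall j,
        (lebesgue_measure (I j) <= M%:E)%E /\
        (lebesgue_measure (Z j) <= M%:E)%E) ->
     (forall j, circulation (Z j) (I j) (G j)) ->
     (forall j, bounded_circulation (Z j) (I j) (w j) (G j)) ->
     ((w j ^+ 2)%:E * (1 + log1 (energy (Z j) (I j) (G j)) (w j ^+ 2)))%E
       @[j --> \oo] --> 0%E ->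
     integral_mu5 (Z j) (I j) (fun r z t => angular (G j) r z t ^+ 2)
       @[j --> \oo] --> 0%E).
Proof.
split=> [I Z w G itvI bI itvZ bZ circG Gw|I Z w G itv [M IZM] circG Gw w0].
  have [mI Ioo] := bounded_interval_finite _ itvI bI.
  have [mZ Zoo] := bounded_interval_finite _ itvZ bZ.
  exact: circulation_estimate_log.
(* The integrals are squeezed between 0 and [1 + M ^+ 2] times the quantity assumed to tend to 0. *)
have := cvgeZl (y := (1 + M ^+ 2)%:E) isT w0; rewrite mule0 => w0'.
apply: (squeeze_cvge _ (cvg_cst 0%E) w0').
apply: nearW => j; rewrite integral_mu5_angular.
have [itvI itvZ] := itv j; have [IM ZM] := IZM j.
apply/andP; split.
  apply: integral_ge0 => t _; apply: integral_ge0 => z _; apply: integral_ge0 => r /=.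
  by rewrite in_itv/= => /andP[r0 _]; rewrite lee_fin divr_ge0 ?sqr_ge0 ?ltW.
by apply: circulation_estimate_uniform => //; exact: is_interval_measurable.
Qed.
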